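(* Let $k=\mathbb{C}$ and let $D=A_1(k)=k\langle t,\partial\rangle$ be the first Weyl algebra, with relation $[\partial,t]=1$, graded by $\deg t=1$ and $\deg\partial=-1$. Let $E=t\partial$ and $J^*=\{\alpha\in k:0\le\mathrm{Re}(\alpha)<1,\ \alpha\neq 0\}$. Then the simple graded left $D$-modules, up to graded isomorphisms and twists, are given by $$M_0=D/D\partial,\qquad M_\infty=D/Dt,\qquad M_\alpha=D/D(E-\alpha)\ \text{ for all } \alpha\in J^*,$$ that is, each of these modules is a simple graded left $D$-module, and every simple graded left $D$-module is isomorphic, as a graded module, to a twist of exactly one of them.
   Context: Graded left modules are $\mathbb{Z}$-graded; graded morphisms are homogeneous of degree zero. The twist $M[n]$ of a graded module $M$ by an integer $n$ is the same module with grading $M[n]_i=M_{n+i}$. A simple graded left $D$-module is a simple object in the category of graded left $D$-modules (equivalently, a graded left $D$-module that is simple as an ungraded module). The cyclic modules above are graded with the class of $1$ in degree $0$. *)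

(* Defs.v *)
From HB Require Import structures.
From mathcomp Require Import all_boot all_order all_algebra.
From mathcomp Require Import finmap boolp reals complex monalg.

Set Implicit Arguments.
Unset Strict Implicit.
Unset Printing Implicit Defensive.

Import GRing.Theory Num.Theory.
Local Open Scope ring_scope.
Local Open Scope quotient_scope.

(* [gr] exhibits [V] as the internal direct sum of the subgroups [gr i]. *)
Record is_grading (V : zmodType) (gr : int -> {pred V}) : Prop := IsGrading {
  grading_zmod : forall i, zmod_closed (gr i);
  grading_span : forall v, exists (s : seq int) (f : int -> V),
    [/\ uniq s, forall i, f i \in gr i & v = \sum_(i <- s) f i];
  grading_direct : forall (s : seq int) (f : int -> V),
    uniq s -> (forall i, f i \in gr i) -> \sum_(i <- s) f i = 0 ->
    {in s, forall i, f i = 0}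
}.

Record gradedRing := GradedRing {
  gring_sort :> pzRingType;
  gring_part : int -> {pred gring_sort};
  gring_grading : is_grading gring_part;
  gring_one : 1 \in gring_part 0;
  gring_mul : forall i j a b, a \in gring_part i -> b \in gring_part j ->
    a * b \in gring_part (i + j)
}.

Record gradedModule (D : gradedRing) := GradedModule {
  gmod_sort :> lmodType D;
  gmod_part : int -> {pred gmod_sort};
  gmod_grading : is_grading gmod_part;
  gmod_scale : forall i j a v, a \in gring_part i -> v \in gmod_part j ->
    a *: v \in gmod_part (i + j)
}.

Section GradedModules.
Variable D : gradedRing.
Implicit Types M N : gradedModule D.

Record gradedHom M N := GradedHom {
  ghom_fun :> {linear M -> N};
  ghom_part : forall i v, v \in gmod_part i -> ghom_fun v \in gmod_part i
}.

Definition graded_iso M N : Prop :=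
  exists (f : gradedHom M N) (g : gradedHom N M), cancel f g /\ cancel g f.

Definition graded_submodule M (U : {pred M}) : Prop :=
  submod_closed U /\
  forall u, u \in U -> exists (s : seq int) (f : int -> M),
    [/\ uniq s, forall i, f i \in gmod_part i, forall i, f i \in U
      & u = \sum_(i <- s) f i].

(* The subobjects of [M] in the category of graded modules are its graded
   submodules. *)
Definition graded_simple M : Prop :=
  (exists v : M, v != 0) /\
  forall U : {pred M}, graded_submodule U -> U =i pred1 0 \/ U =i predT.

Lemma twist_grading M (n : int) :
  is_grading (fun i => gmod_part (g := M) (n + i)).
Proof.
have [Z S U] := gmod_grading M; split=> [i|v|s f us fP f0]; first exact: Z.
  have [s [f [us fP ->]]] := S v.
  exists [seq i - n | i <- s], (fun i => f (n + i)); split=> //.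
    by rewrite map_inj_uniq // => i j /addIr.
  by rewrite big_map; apply: eq_bigr => i _; rewrite [n + _]addrC subrK.
move=> i si; have := U [seq n + j | j <- s] (fun j => f (j - n)).
have nK j : n + j - n = j by rewrite addrC addKr.
rewrite map_inj_uniq; last exact: addrI.
move=> /(_ us) H; have := H _ _ (n + i); rewrite nK; apply.
- by move=> j; have := fP (j - n); rewrite [n + _]addrC subrK.
- by rewrite big_map -[RHS]f0; apply: eq_bigr => j _; rewrite nK.
- exact: map_f.
Qed.

Lemma twist_scale M (n : int) i j (a : D) (v : M) : a \in gring_part i ->
  v \in gmod_part (n + j) -> a *: v \in gmod_part (n + (i + j)).
Proof. by move=> aP vP; rewrite addrCA; apply: gmod_scale. Qed.

Definition twist M (n : int) : gradedModule D :=
  GradedModule (twist_grading M n) (@twist_scale M n).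

End GradedModules.

Section CyclicModule.
Variables (D : gradedRing) (x : D).

Definition left_ideal : {pred D} := [pred a | `[< exists b, a = b * x >]].

Lemma left_idealP a : reflect (exists b, a = b * x) (a \in left_ideal).
Proof. exact: asboolP. Qed.

Lemma left_ideal_zmod_closed : zmod_closed left_ideal.
Proof.
split=> [|a b /left_idealP[a' ->] /left_idealP[b' ->]]; apply/left_idealP.
  by exists 0; rewrite mul0r.
by exists (a' - b'); rewrite mulrBl.
Qed.

HB.instance Definition _ :=
  GRing.isZmodClosed.Build D left_ideal left_ideal_zmod_closed.

Lemma left_idealM a b : b \in left_ideal -> a * b \in left_ideal.
Proof. by case/left_idealP=> c ->; apply/left_idealP; exists (a * c); rewrite mulrA. Qed.

(* D / Dx *)
Definition cyclic := Quotient.quot left_ideal.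

HB.instance Definition _ := GRing.Zmodule.on cyclic.
HB.instance Definition _ := EqQuotient.on cyclic.

Definition cyclic_pi (a : D) : cyclic := \pi a.

Lemma cyclic_piB : {morph cyclic_pi : a b / a - b}.
Proof. by move=> a b; rewrite /cyclic_pi !piE. Qed.

Lemma cyclic_piD : {morph cyclic_pi : a b / a + b}.
Proof. by move=> a b; rewrite /cyclic_pi !piE. Qed.

Lemma cyclic_pi_eq a b : (cyclic_pi a == cyclic_pi b) = (a - b \in left_ideal).
Proof. by rewrite Quotient.idealrBE. Qed.

Lemma cyclic_pi_eq0 a : (cyclic_pi a == 0) = (a \in left_ideal).
Proof. by rewrite -[a in RHS]subr0 -cyclic_pi_eq /cyclic_pi !piE. Qed.

Lemma cyclic_reprK (v : cyclic) : cyclic_pi (repr v) = v.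
Proof. exact: reprK. Qed.

Definition cyclic_scale (a : D) (v : cyclic) : cyclic := cyclic_pi (a * repr v).

Lemma cyclic_scaleE a b : cyclic_scale a (cyclic_pi b) = cyclic_pi (a * b).
Proof.
apply/eqP; rewrite cyclic_pi_eq -mulrBr left_idealM //.
by rewrite -cyclic_pi_eq cyclic_reprK.
Qed.

Lemma cyclic_scaleA a b v :
  cyclic_scale a (cyclic_scale b v) = cyclic_scale (a * b) v.
Proof. by rewrite -(cyclic_reprK v) !cyclic_scaleE mulrA. Qed.

Lemma cyclic_scale1 : left_id 1 cyclic_scale.
Proof. by move=> v; rewrite -(cyclic_reprK v) cyclic_scaleE mul1r. Qed.

Lemma cyclic_scaleDr : right_distributive cyclic_scale +%R.
Proof.
move=> a u v; rewrite -(cyclic_reprK u) -(cyclic_reprK v).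
by rewrite -cyclic_piD !cyclic_scaleE mulrDr cyclic_piD.
Qed.

Lemma cyclic_scaleDl v : {morph cyclic_scale^~ v : a b / a + b}.
Proof.
by move=> a b; rewrite -(cyclic_reprK v) !cyclic_scaleE mulrDl cyclic_piD.
Qed.

HB.instance Definition _ := GRing.Zmodule_isLmodule.Build D cyclic
  cyclic_scaleA cyclic_scale1 cyclic_scaleDr cyclic_scaleDl.

(* The class of 1 lies in degree 0. *)
Definition cyclic_part (i : int) : {pred cyclic} :=
  [pred v | `[< exists2 a, a \in gring_part i & v = cyclic_pi a >]].

Lemma cyclic_partP i v :
  reflect (exists2 a, a \in gring_part i & v = cyclic_pi a)
          (v \in cyclic_part i).
Proof. exact: asboolP. Qed.

Lemma cyclic_pi_sum (s : seq int) (f : int -> D) :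
  cyclic_pi (\sum_(i <- s) f i) = \sum_(i <- s) cyclic_pi (f i).
Proof. by apply: big_morph => [a b|]; rewrite ?cyclic_piD // /cyclic_pi !piE. Qed.

Lemma cyclic_part_scale i j (a : D) (v : cyclic) : a \in gring_part i ->
  v \in cyclic_part j -> a *: v \in cyclic_part (i + j).
Proof.
move=> aP /cyclic_partP[b bP ->]; apply/cyclic_partP; exists (a * b).
  exact: gring_mul.
exact: cyclic_scaleE.
Qed.

Variables (d : int) (xd : x \in gring_part d).

Lemma cyclic_grading : is_grading cyclic_part.
Proof.
have [Z S U] := gring_grading D; split=> [i|v|s f us fP f0].
- have [Z0 ZB] := Z i; split=> [|u v /cyclic_partP[a aP ->] /cyclic_partP[b bP ->]].
    by apply/cyclic_partP; exists 0; rewrite // /cyclic_pi !piE.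
  by apply/cyclic_partP; exists (a - b); rewrite ?cyclic_piB ?ZB.
- have [s [f [us fP vE]]] := S (repr v).
  exists s, (cyclic_pi \o f); split=> //.
    by move=> i; apply/cyclic_partP; exists (f i).
  by rewrite -(cyclic_reprK v) vE cyclic_pi_sum.
have /choice[a aP] : forall i, exists a, a \in gring_part i /\ f i = cyclic_pi a.
  by move=> i; have /cyclic_partP[a ? ?] := fP i; exists a.
have : \sum_(i <- s) a i \in left_ideal.
  rewrite -cyclic_pi_eq0 cyclic_pi_sum -[X in _ == X]f0; apply/eqP.
  by apply: eq_bigr => i _; case: (aP i).
case/left_idealP=> b; have [r [g [ur gP ->]]] := S b => sumE.
pose c i := (if i \in s then a i else 0)
            - (if i - d \in r then g (i - d) * x else 0).
pose t := undup (s ++ [seq j + d | j <- r]).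
have cP i : c i \in gring_part i.
  have [Z0 ZB] := Z i; apply: ZB; case: ifP => // _; first by case: (aP i).
  by have := gring_mul (gP (i - d)) xd; rewrite subrK.
have c0 : \sum_(i <- t) c i = 0.
  rewrite /c sumrB.
  have -> : \sum_(i <- t) (if i \in s then a i else 0) = \sum_(i <- s) a i.
    rewrite -big_mkcond /= -big_filter; apply: perm_big; apply: uniq_perm => //; first by rewrite filter_uniq ?undup_uniq.
    by move=> i; rewrite mem_filter mem_undup mem_cat; case: (i \in s).
  have -> : \sum_(i <- t) (if i - d \in r then g (i - d) * x else 0)
      = \sum_(i <- [seq j + d | j <- r]) g (i - d) * x.
    rewrite -big_mkcond /= -big_filter; apply: perm_big; apply: uniq_perm.
    - by rewrite filter_uniq ?undup_uniq.
    - by rewrite map_inj_uniq // => i j /addIr.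
    move=> i; rewrite mem_filter mem_undup mem_cat.
    have -> : (i \in [seq j + d | j <- r]) = (i - d \in r).
      by rewrite -{1}(subrK d i); exact: (mem_map (@addIr _ d)).
    by case: (i - d \in r); rewrite ?orbT.
  rewrite big_map sumE mulr_suml; apply/eqP; rewrite subr_eq0; apply/eqP.
  by apply: eq_bigr => j _; rewrite addrK.
move=> i si; have [_ ->] := aP i; apply/eqP; rewrite cyclic_pi_eq0.
have := U t c (undup_uniq _) cP c0 i.
rewrite mem_undup mem_cat si /c => /(_ isT)/eqP; rewrite si subr_eq0 => /eqP->.
by apply/left_idealP; case: ifP => _; [exists (g (i - d)) | exists 0; rewrite mul0r].
Qed.

Definition cyclicModule : gradedModule D :=
  GradedModule cyclic_grading cyclic_part_scale.

End CyclicModule.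

Section WeylAlgebra.
Variable k : fieldType.

(* The free algebra k<t, d>; the letter [false] stands for t, [true] for d. *)
Definition free2 := {malg k[{fmonom bool}]}.
HB.instance Definition _ := GRing.Lalgebra.on free2.

Definition free_t : free2 := << fmu false >>.
Definition free_d : free2 := << fmu true >>.

Definition weyl_rel : free2 := free_d * free_t - free_t * free_d - 1.

Definition weyl_ideal : {pred free2} := [pred a |
  `[< exists s : seq (free2 * free2), a = \sum_(p <- s) p.1 * weyl_rel * p.2 >]].

Lemma weyl_idealP a :
  reflect (exists s : seq (free2 * free2), a = \sum_(p <- s) p.1 * weyl_rel * p.2)
          (a \in weyl_ideal).
Proof. exact: asboolP. Qed.

Lemma weyl_ideal_zmod_closed : zmod_closed weyl_ideal.
Proof.
split=> [|a b /weyl_idealP[s ->] /weyl_idealP[r ->]]; apply/weyl_idealP.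
  by exists [::]; rewrite big_nil.
exists (s ++ [seq (- p.1, p.2) | p <- r]); rewrite big_cat big_map /=.
by rewrite -sumrN; congr (_ + _); apply: eq_bigr => p _; rewrite !mulNr.
Qed.

HB.instance Definition _ :=
  GRing.isZmodClosed.Build free2 weyl_ideal weyl_ideal_zmod_closed.

Lemma weyl_idealMl a b : b \in weyl_ideal -> a * b \in weyl_ideal.
Proof.
case/weyl_idealP=> s ->; apply/weyl_idealP; exists [seq (a * p.1, p.2) | p <- s].
by rewrite big_map mulr_sumr; apply: eq_bigr => p _; rewrite !mulrA.
Qed.

Lemma weyl_idealMr a b : a \in weyl_ideal -> a * b \in weyl_ideal.
Proof.
case/weyl_idealP=> s ->; apply/weyl_idealP; exists [seq (p.1, p.2 * b) | p <- s].
by rewrite big_map mulr_suml; apply: eq_bigr => p _; rewrite !mulrA.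
Qed.

(* The action of k<t, d> on k[X] by multiplication by X and by d/dX factors
   through the quotient by [weyl_ideal], which is therefore nontrivial. *)
Definition act_word (m : {fmonom bool}) (p : {poly k}) : {poly k} :=
  foldr (fun b q => if b then q^`() else 'X * q) p m.

Definition act (a : free2) (p : {poly k}) : {poly k} :=
  \sum_(m <- msupp a) a@_m *: act_word m p.

Lemma act_wordD m : {morph act_word m : p q / p + q}.
Proof.
move=> p q; rewrite /act_word; elim: (fmonom_val m) => //= -[] s ->.
  exact: derivD.
exact: mulrDr.
Qed.

Lemma act_wordZ m c p : act_word m (c *: p) = c *: act_word m p.
Proof.
rewrite /act_word; elim: (fmonom_val m) => //= -[] s ->; first exact: derivZ.
by rewrite scalerAr.
Qed.

Lemma act_wordM m1 m2 p : act_word (mmul m1 m2) p = act_word m1 (act_word m2 p).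
Proof. by rewrite /act_word [mmul m1 m2]fmmulE /= foldr_cat. Qed.

Lemma actEw (s : {fset {fmonom bool}}) a p : (msupp a `<=` s)%fset ->
  act a p = \sum_(m <- s) a@_m *: act_word m p.
Proof.
move=> le; rewrite /act (big_fset_incl _ le) // => m _ /mcoeff_outdom->.
exact: scale0r.
Qed.

Lemma actD a b p : act (a + b) p = act a p + act b p.
Proof.
rewrite (actEw _ (msuppD_le a b)) (actEw _ (fsubsetUl (msupp a) (msupp b))).
rewrite (actEw _ (fsubsetUr (msupp a) (msupp b))) -big_split /=.
by apply: eq_bigr => m _; rewrite mcoeffD scalerDl.
Qed.

Lemma act0 p : act 0 p = 0.
Proof. by rewrite /act msupp0 big_seq_fset0. Qed.

Lemma actU c m p : act << c *g m >> p = c *: act_word m p.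
Proof. by rewrite (actEw _ msuppU_le) big_seq_fset1 mcoeffUU. Qed.

Lemma act_sum (I : Type) (r : seq I) (F : I -> free2) p :
  act (\sum_(i <- r) F i) p = \sum_(i <- r) act (F i) p.
Proof. by apply: (big_morph (act^~ p)) => [a b|]; rewrite ?actD ?act0. Qed.

Lemma actN a p : act (- a) p = - act a p.
Proof. by apply/eqP; rewrite -addr_eq0 -actD addNr act0. Qed.

Lemma act_wordS m (I : Type) (r : seq I) (F : I -> {poly k}) :
  act_word m (\sum_(i <- r) F i) = \sum_(i <- r) act_word m (F i).
Proof.
apply: (big_morph (act_word m)) => [p q|]; first exact: act_wordD.
by rewrite -[0](scale0r 0) act_wordZ !scale0r.
Qed.

Lemma actM a b p : act (a * b) p = act a (act b p).
Proof.
rewrite malgME act_sum [act a _]/act; apply: eq_bigr => m _.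
rewrite act_sum [act b p]/act act_wordS scaler_sumr; apply: eq_bigr => m' _.
by rewrite actU act_wordM act_wordZ scalerA.
Qed.

Lemma act_1 p : act 1 p = p.
Proof. by rewrite [1]/(<< _ >>) actU scale1r /act_word [mone]fmoneE. Qed.

Lemma act_weyl_rel p : act weyl_rel p = 0.
Proof.
rewrite /weyl_rel !actD !actN !actM act_1 !actU !scale1r /act_word !fmuE /=.
by rewrite derivM derivX mul1r addrK subrr.
Qed.

Lemma act_weyl_ideal a p : a \in weyl_ideal -> act a p = 0.
Proof.
case/weyl_idealP=> s ->; rewrite act_sum big1 // => -[u v] _ /=.
by rewrite -mulrA !actM act_weyl_rel /act big1 // => m _;
   rewrite -[0](scale0r 0) act_wordZ !scale0r scaler0.
Qed.

(* k<t, d> / (d t - t d - 1) *)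
Definition weyl := Quotient.quot weyl_ideal.

HB.instance Definition _ := GRing.Zmodule.on weyl.
HB.instance Definition _ := EqQuotient.on weyl.

Definition weyl_pi (a : free2) : weyl := \pi a.

Lemma weyl_piD : {morph weyl_pi : a b / a + b}.
Proof. by move=> a b; rewrite /weyl_pi !piE. Qed.

Lemma weyl_piB : {morph weyl_pi : a b / a - b}.
Proof. by move=> a b; rewrite /weyl_pi !piE. Qed.

Lemma weyl_pi_eq a b : (weyl_pi a == weyl_pi b) = (a - b \in weyl_ideal).
Proof. by rewrite Quotient.idealrBE. Qed.

Lemma weyl_pi_eq0 a : (weyl_pi a == 0) = (a \in weyl_ideal).
Proof. by rewrite -[a in RHS]subr0 -weyl_pi_eq /weyl_pi !piE. Qed.

Lemma weyl_reprK (x : weyl) : weyl_pi (repr x) = x.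
Proof. exact: reprK. Qed.

Definition weyl_one : weyl := weyl_pi 1.
Definition weyl_mul (x y : weyl) : weyl := weyl_pi (repr x * repr y).

Lemma weyl_mulE a b : weyl_mul (weyl_pi a) (weyl_pi b) = weyl_pi (a * b).
Proof.
have reprP c : repr (weyl_pi c) - c \in weyl_ideal.
  by rewrite -weyl_pi_eq weyl_reprK.
apply/eqP; rewrite weyl_pi_eq -[X in X - _](subrK (repr (weyl_pi a) * b)).
rewrite -mulrBr -addrA -mulrBl.
by apply: rpredD; [apply: weyl_idealMl | apply: weyl_idealMr].
Qed.

Lemma weyl_mulA : associative weyl_mul.
Proof.
move=> x y z; rewrite -(weyl_reprK x) -(weyl_reprK y) -(weyl_reprK z).
by rewrite !weyl_mulE mulrA.
Qed.

Lemma weyl_mul1l : left_id weyl_one weyl_mul.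
Proof. by move=> x; rewrite -(weyl_reprK x) weyl_mulE mul1r. Qed.

Lemma weyl_mul1r : right_id weyl_one weyl_mul.
Proof. by move=> x; rewrite -(weyl_reprK x) weyl_mulE mulr1. Qed.

Lemma weyl_mulDl : left_distributive weyl_mul +%R.
Proof.
move=> x y z; rewrite -(weyl_reprK x) -(weyl_reprK y) -(weyl_reprK z).
by rewrite -weyl_piD !weyl_mulE mulrDl weyl_piD.
Qed.

Lemma weyl_mulDr : right_distributive weyl_mul +%R.
Proof.
move=> x y z; rewrite -(weyl_reprK x) -(weyl_reprK y) -(weyl_reprK z).
by rewrite -weyl_piD !weyl_mulE mulrDr weyl_piD.
Qed.

Lemma weyl_one_neq0 : weyl_one != 0.
Proof.
rewrite weyl_pi_eq0; apply/negP => /(act_weyl_ideal 1)/eqP.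
by rewrite act_1 oner_eq0.
Qed.

HB.instance Definition _ := GRing.Zmodule_isNzRing.Build weyl
  weyl_mulA weyl_mul1l weyl_mul1r weyl_mulDl weyl_mulDr weyl_one_neq0.

Lemma weyl_piM : {morph weyl_pi : a b / a * b}.
Proof. by move=> a b; rewrite -weyl_mulE. Qed.

Definition weyl_scale (c : k) (x : weyl) : weyl := weyl_pi (c *: repr x).

Lemma weyl_scaleE c a : weyl_scale c (weyl_pi a) = weyl_pi (c *: a).
Proof.
apply/eqP; rewrite weyl_pi_eq -scalerBr -mul_malgC weyl_idealMl //.
by rewrite -weyl_pi_eq weyl_reprK.
Qed.

Lemma weyl_scaleA c1 c2 x :
  weyl_scale c1 (weyl_scale c2 x) = weyl_scale (c1 * c2) x.
Proof. by rewrite -(weyl_reprK x) !weyl_scaleE scalerA. Qed.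

Lemma weyl_scale1 : left_id 1 weyl_scale.
Proof. by move=> x; rewrite -(weyl_reprK x) weyl_scaleE scale1r. Qed.

Lemma weyl_scaleDr : right_distributive weyl_scale +%R.
Proof.
move=> c x y; rewrite -(weyl_reprK x) -(weyl_reprK y).
by rewrite -weyl_piD !weyl_scaleE scalerDr weyl_piD.
Qed.

Lemma weyl_scaleDl x : {morph weyl_scale^~ x : c1 c2 / c1 + c2}.
Proof.
by move=> c1 c2; rewrite -(weyl_reprK x) !weyl_scaleE scalerDl weyl_piD.
Qed.

HB.instance Definition _ := GRing.Zmodule_isLmodule.Build k weyl
  weyl_scaleA weyl_scale1 weyl_scaleDr weyl_scaleDl.

Lemma weyl_piZ c a : weyl_pi (c *: a) = c *: weyl_pi a.
Proof. by rewrite -weyl_scaleE. Qed.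

Lemma weyl_scaleAl (c : k) (x y : weyl) : c *: (x * y) = (c *: x) * y.
Proof.
rewrite -(weyl_reprK x) -(weyl_reprK y).
by rewrite -weyl_piM -!weyl_piZ -weyl_piM scalerAl.
Qed.

HB.instance Definition _ :=
  GRing.Lmodule_isLalgebra.Build k weyl weyl_scaleAl.

Lemma free2_mulC (c : k) (a : free2) : a * c%:MP = c%:MP * a.
Proof.
rewrite [a]monalgE mulr_suml mulr_sumr; apply: eq_bigr => m _.
by rewrite !malgM_def !fgmulUU mulm1 mul1m mulrC.
Qed.

Lemma weyl_scaleAr (c : k) (x y : weyl) : c *: (x * y) = x * (c *: y).
Proof.
rewrite -(weyl_reprK x) -(weyl_reprK y).
by rewrite -weyl_piM -!weyl_piZ -weyl_piM -!mul_malgC !mulrA free2_mulC.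
Qed.

HB.instance Definition _ :=
  GRing.Lalgebra_isAlgebra.Build k weyl weyl_scaleAr.

Definition weyl_t : weyl := weyl_pi free_t.
Definition weyl_d : weyl := weyl_pi free_d.
Definition weyl_E : weyl := weyl_t * weyl_d.

Lemma weyl_commutator : weyl_d * weyl_t - weyl_t * weyl_d = 1.
Proof.
rewrite -!weyl_piM -weyl_piB; apply/eqP.
rewrite -[1]/(weyl_pi 1) weyl_pi_eq; apply/weyl_idealP.
by exists [:: (1, 1)]; rewrite big_seq1 mul1r mulr1.
Qed.

(* deg t = 1 and deg d = -1. *)
Definition wdeg (m : {fmonom bool}) : int :=
  (count_mem false m)%:Z - (count_mem true m)%:Z.

Definition free_part (i : int) : {pred free2} :=
  [pred a | all (fun m => wdeg m == i) (msupp a)].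

Definition weyl_part (i : int) : {pred weyl} :=
  [pred x | `[< exists2 a, a \in free_part i & x = weyl_pi a >]].

Lemma weyl_partP i x :
  reflect (exists2 a, a \in free_part i & x = weyl_pi a) (x \in weyl_part i).
Proof. exact: asboolP. Qed.

Lemma free_partP i a :
  reflect (forall m, wdeg m != i -> a@_m = 0) (a \in free_part i).
Proof.
apply: (iffP allP) => [H m mi|H m]; last first.
  by rewrite -mcoeff_neq0; apply: contraNT => /H ->.
by apply/eqP; apply: contraNT mi; rewrite mcoeff_neq0 => /H.
Qed.

Lemma free_part_zmod_closed i : zmod_closed (free_part i).
Proof.
split=> [|a b /free_partP aP /free_partP bP]; apply/free_partP => m mi.
  exact: mcoeff0.
by rewrite mcoeffB aP // bP // subrr.
Qed.

HB.instance Definition _ i :=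
  GRing.isZmodClosed.Build free2 (free_part i) (free_part_zmod_closed i).

Lemma wdegM m1 m2 : wdeg (mmul m1 m2) = wdeg m1 + wdeg m2.
Proof.
by rewrite /wdeg [mmul m1 m2]fmmulE !count_cat !PoszD opprD addrACA.
Qed.

Lemma free_partU i c m : wdeg m = i -> << c *g m >> \in free_part i.
Proof.
move=> mi; apply/free_partP => m' m'i; rewrite mcoeffU.
by case: (eqVneq m m') m'i => [<-|//]; rewrite mi eqxx.
Qed.

Lemma free_partM i j a b :
  a \in free_part i -> b \in free_part j -> a * b \in free_part (i + j).
Proof.
move=> /allP aP /allP bP; rewrite malgME big_seq; apply: rpred_sum => m1 m1a.
rewrite big_seq; apply: rpred_sum => m2 m2b; apply: free_partU.
by rewrite wdegM (eqP (aP _ m1a)) (eqP (bP _ m2b)).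
Qed.

Lemma free_part1 : 1 \in free_part 0.
Proof.
by apply: free_partU; rewrite /wdeg [mone]fmoneE.
Qed.

Lemma free_part_t : free_t \in free_part 1.
Proof. by apply: free_partU; rewrite /wdeg fmuE. Qed.

Lemma free_part_d : free_d \in free_part (-1).
Proof. by apply: free_partU; rewrite /wdeg fmuE. Qed.

Lemma weyl_rel_part : weyl_rel \in free_part 0.
Proof.
rewrite /weyl_rel !rpredB ?free_part1 //.
  by rewrite -[0](addNr 1) free_partM ?free_part_t ?free_part_d.
by rewrite -[0](addrN 1) free_partM ?free_part_t ?free_part_d.
Qed.

Definition free_proj (i : int) (a : free2) : free2 :=
  \sum_(m <- msupp a | wdeg m == i) << a@_m *g m >>.

Lemma free_projE i a m : (free_proj i a)@_m = if wdeg m == i then a@_m else 0.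
Proof.
rewrite /free_proj raddf_sum /=.
under eq_bigr do rewrite mcoeffU.
have [ma|ma] := boolP (m \in msupp a); last first.
  rewrite (mcoeff_outdom ma) if_same big_seq_cond big1 // => m' /andP[m'a _].
  by case: (eqVneq m' m) m'a ma => [->->|].
rewrite big_mkcond (bigD1_seq m) //= eqxx mulr1n big1 ?addr0 //.
by move=> m' /negPf->; rewrite mulr0n if_same.
Qed.

Lemma free_projD i : {morph free_proj i : a b / a + b}.
Proof.
move=> a b; apply/malgP => m.
by rewrite mcoeffD !free_projE mcoeffD; case: ifP; rewrite ?addr0.
Qed.

Lemma free_proj0 i : free_proj i 0 = 0.
Proof. by apply/malgP => m; rewrite free_projE mcoeff0 if_same. Qed.

Lemma free_proj_sum i (I : Type) (r : seq I) (F : I -> free2) :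
  free_proj i (\sum_(j <- r) F j) = \sum_(j <- r) free_proj i (F j).
Proof. exact: (big_morph _ (free_projD i) (free_proj0 i)). Qed.

Lemma free_proj_part i a : free_proj i a \in free_part i.
Proof.
by apply/free_partP => m mi; rewrite free_projE (negPf mi).
Qed.

Lemma free_proj_id i j a : a \in free_part j ->
  free_proj i a = if i == j then a else 0.
Proof.
move=> /free_partP aP; apply/malgP => m; rewrite free_projE.
case: (eqVneq i j) => [->|ij]; first by case: eqVneq => // /aP->.
rewrite mcoeff0; case: (eqVneq (wdeg m) i) => // mi.
by rewrite aP // mi.
Qed.

Lemma free_proj_ideal i a : a \in weyl_ideal -> free_proj i a \in weyl_ideal.
Proof.
case/weyl_idealP=> s ->; rewrite free_proj_sum rpred_sum // => -[u v] _ /=.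
have [rI rP] : weyl_rel \in weyl_ideal /\ weyl_rel \in free_part 0.
  split; last exact: weyl_rel_part.
  by apply/weyl_idealP; exists [:: (1, 1)]; rewrite big_seq1 mul1r mulr1.
move: weyl_rel rI rP => r rI rP.
have rvE : r * v = \sum_(m <- msupp v) r * << v@_m *g m >>.
  by rewrite [v in LHS]monalgE mulr_sumr.
rewrite [u]monalgE -mulrA rvE mulr_suml free_proj_sum.
rewrite rpred_sum // => m _; rewrite mulr_sumr free_proj_sum.
rewrite rpred_sum // => m' _; rewrite (@free_proj_id _ (wdeg m + (0 + wdeg m'))).
  case: ifP => _; last exact: rpred0.
  by apply: weyl_idealMl; apply: weyl_idealMr.
by rewrite !free_partM ?free_partU.
Qed.

Lemma weyl_pi_sum (s : seq int) (f : int -> free2) :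
  weyl_pi (\sum_(i <- s) f i) = \sum_(i <- s) weyl_pi (f i).
Proof. by apply: big_morph => [a b|]; rewrite ?weyl_piD // /weyl_pi !piE. Qed.

Lemma weyl_grading : is_grading weyl_part.
Proof.
split=> [i|x|s f us fP f0].
- split=> [|x y /weyl_partP[a aP ->] /weyl_partP[b bP ->]]; apply/weyl_partP.
    by exists 0; rewrite ?rpred0 // /weyl_pi !piE.
  by exists (a - b); rewrite ?rpredB ?weyl_piB.
- pose a := repr x; pose s := undup [seq wdeg m | m <- msupp a].
  exists s, (fun i => weyl_pi (free_proj i a)); split; first exact: undup_uniq.
    by move=> i; apply/weyl_partP; exists (free_proj i a); rewrite ?free_proj_part.
  rewrite -weyl_pi_sum -[LHS]weyl_reprK; congr weyl_pi.
  apply/malgP => m; rewrite raddf_sum /=.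
  under eq_bigr do rewrite free_projE.
  have [ma|ma] := boolP (m \in msupp a); last first.
    rewrite -/a (mcoeff_outdom ma) big1 // => i _; exact: if_same.
  rewrite (bigD1_seq (wdeg m)) ?undup_uniq ?mem_undup ?map_f //= eqxx.
  rewrite big1 ?addr0 // => i im; by rewrite eq_sym (negPf im).
have /choice[a aP] : forall i, exists a, a \in free_part i /\ f i = weyl_pi a.
  by move=> i; have /weyl_partP[a ? ?] := fP i; exists a.
have sI : \sum_(i <- s) a i \in weyl_ideal.
  rewrite -weyl_pi_eq0 weyl_pi_sum -[X in _ == X]f0; apply/eqP.
  by apply: eq_bigr => i _; case: (aP i).
move=> i si; have [_ ->] := aP i; apply/eqP; rewrite weyl_pi_eq0.
have := free_proj_ideal i sI; rewrite free_proj_sum (bigD1_seq i) //=.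
rewrite (free_proj_id _ (aP i).1) eqxx big1 ?addr0 // => j ji.
by rewrite (free_proj_id _ (aP j).1) eq_sym (negPf ji).
Qed.

Lemma weyl_part1 : 1 \in weyl_part 0.
Proof. by apply/weyl_partP; exists 1; rewrite ?free_part1. Qed.

Lemma weyl_partM i j x y :
  x \in weyl_part i -> y \in weyl_part j -> x * y \in weyl_part (i + j).
Proof.
move=> /weyl_partP[a aP ->] /weyl_partP[b bP ->]; apply/weyl_partP.
by exists (a * b); rewrite ?free_partM ?weyl_piM.
Qed.

Definition A1 : gradedRing := GradedRing weyl_grading weyl_part1 weyl_partM.

Lemma weyl_t_part : weyl_t \in weyl_part 1.
Proof. by apply/weyl_partP; exists free_t; rewrite ?free_part_t. Qed.

Lemma weyl_d_part : weyl_d \in weyl_part (-1).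
Proof. by apply/weyl_partP; exists free_d; rewrite ?free_part_d. Qed.

Lemma weyl_E_part (a : k) : weyl_E - a%:A \in weyl_part 0.
Proof.
have [_ ZB] := grading_zmod weyl_grading 0; apply: ZB.
  by rewrite -[0](addrN 1) weyl_partM ?weyl_t_part ?weyl_d_part.
apply/weyl_partP; exists (a *: 1); last by rewrite weyl_piZ.
by rewrite -mul_malgC mulr1; apply: free_partU; rewrite /wdeg [mone]fmoneE.
Qed.

Definition M_zero : gradedModule A1 := @cyclicModule A1 weyl_d _ weyl_d_part.
Definition M_infty : gradedModule A1 := @cyclicModule A1 weyl_t _ weyl_t_part.
Definition M_alpha (a : k) : gradedModule A1 :=
  @cyclicModule A1 (weyl_E - a%:A) _ (weyl_E_part a).

End WeylAlgebra.

(* R[i] is the field of complex numbers over the real numbers [R]. *)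
Definition Jstar (R : realType) : {pred R[i]} :=
  [pred a | (0 <= complex.Re a < 1) && (a != 0)].
Arguments Jstar R : clear implicits.

Inductive label (R : realType) : Type :=
  | Lzero
  | Linfty
  | Lalpha (a : R[i]) of a \in Jstar R.

Definition M_ (R : realType) (l : label R) : gradedModule (A1 R[i]) :=
  match l with
  | Lzero => M_zero R[i]
  | Linfty => M_infty R[i]
  | Lalpha a _ => M_alpha a
  end.

(* Main.v *)
From HB Require Import structures.
Require Import Defs.
From mathcomp Require Import all_boot all_order all_algebra.
From mathcomp Require Import reals complex.
From mathcomp Require Import boolp finmap monalg.

Set Implicit Arguments.
Unset Strict Implicit.
Unset Printing Implicit Defensive.

Import Order.TTheory GRing.Theory Num.Theory.
Local Open Scope ring_scope.

(** The degree [i] part of the Weyl algebra is [k[E] t^i], where [t^(-1)] is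
    read as [d] ([weyl_partE]), and [E a = a (E + i)] for [a] of degree [i].
    Hence a homogeneous eigenvector of [E] of eigenvalue [a], called below a
    vector of weight [a], is moved by a homogeneous element of degree [i] to
    an eigenvector of eigenvalue [a + i].

    Simplicity.  Each of the modules is [D / D x] with [x] homogeneous, and
    multiplying [x] by the right power of [t] or [d] gives [E - a], with
    [a = 0, -1, alpha] respectively; so the class of 1 has weight [a].  It is
    nonzero because [p(E) (E - a)] is never 1, as [p |-> p(E)] is injective
    (let [E] act on the monomials of [k[X]]).  The products [d^n t^n] and
    [t^n d^n] act on it through the scalars [(a + 1) ... (a + n)] and
    [a (a - 1) ... (a - n + 1)].  These vanish only when [a] is an integer,
    and then only in the direction in which [x] already kills the generator;
    hence every nonzero homogeneous vector can be brought back to the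
    generator ([weight_return]).

    Exhaustion.  Let [N] be graded simple.  A nonzero homogeneous vector [v]
    with [E v != 0] satisfies [v = p(E) E v], since [N] is generated by [E v]
    and the degree 0 part of [D] is [k[E]]; so [v] is killed by the nonzero
    polynomial [p X - 1] in [E], and as [k] is algebraically closed its degree
    contains an eigenvector ([simple_weight]).  If [t] or [d] kills a nonzero
    homogeneous vector of [N], then [N] receives a nonzero map from a twist of
    [D/Dt] or [D/Dd], which is bijective by the graded Schur lemma
    ([schur_twist]).  Otherwise powers of [t] or [d] move the weight by any
    integer without killing the vector, so the real part of the weight can be
    brought into [0, 1[; the weight is then nonzero because [E = t d] is
    injective on homogeneous vectors, and Schur applies again.

    Uniqueness.  The weights of [N] lie in one class modulo the integers
    ([label_weight_iso]), which separates all labels except [D/Dd] and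
    [D/Dt].  These two differ in that a simple [N] cannot contain a homogeneous
    [v] killed by [d] and a homogeneous [w] killed by [t]: comparing weights,
    [w] would lie in [D_(-1) v = k[E] d v = 0] ([kill_td]). *)

(** * Homogeneous maps *)

(** Decompositions into homogeneous components can be compared index by index
    once the family vanishes off its support. *)
Lemma grading_span0 (V : zmodType) (gr : int -> {pred V}) v :
  is_grading gr -> exists (s : seq int) (f : int -> V),
  [/\ uniq s, forall i, f i \in gr i, forall i, i \notin s -> f i = 0
    & v = \sum_(i <- s) f i].
Proof.
move=> [Z S _]; have [s [f [us fP ->]]] := S v.
exists s, (fun i => if i \in s then f i else 0); split=> // [i|i|].
- by case: ifP => // _; case: (Z i).
- by move=> /negPf->.
- by rewrite big_seq [RHS]big_seq; apply: eq_bigr => i ->.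
Qed.

Section Homogeneous.
Variables (V W : zmodType) (gr : int -> {pred V}) (gr' : int -> {pred W}).
Hypotheses (grV : is_grading gr) (grW : is_grading gr').
Variables (phi : V -> W) (d : int).
Hypotheses (phiD : {morph phi : x y / x + y}).
Hypothesis (phi_gr : forall i v, v \in gr i -> phi v \in gr' (i + d)).

Lemma homog_map0 : phi 0 = 0.
Proof. by apply: (@addrI _ (phi 0)); rewrite -phiD !addr0. Qed.

Lemma homog_map_sum (s : seq int) (f : int -> V) :
  phi (\sum_(i <- s) f i) = \sum_(i <- s) phi (f i).
Proof. exact: (big_morph phi phiD homog_map0). Qed.

Lemma homog_map_direct (s : seq int) (f : int -> V) :
  uniq s -> (forall i, f i \in gr i) -> \sum_(i <- s) phi (f i) = 0 ->
  {in s, forall i, phi (f i) = 0}.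
Proof.
move=> us fP f0 i si.
have [_ _ U] := grW.
have := U [seq j + d | j <- s] (fun j => phi (f (j - d))).
rewrite map_inj_uniq; last exact: addIr.
move=> /(_ us) H; have := H _ _ (i + d); rewrite addrK; apply; last exact: map_f.
- by move=> j; have := phi_gr (fP (j - d)); rewrite subrK.
- by rewrite big_map -[RHS]f0; apply: eq_bigr => j _; rewrite addrK.
Qed.

(** Only the component of [a] of degree [n - d] contributes to [phi a].  This
    is how elements of [D] occurring in equations between homogeneous vectors
    are replaced by homogeneous ones. *)
Lemma homog_lift n a : phi a \in gr' n ->
  exists2 b, b \in gr (n - d) & phi a = phi b.
Proof.
have [s [f [us fP f0 aE]]] := grading_span0 a grV.
move=> aP; exists (f (n - d)) => //.
have [Z _ U] := grW.
pose r := undup (n - d :: s).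
have sumr : \sum_(i <- r) phi (f i) = phi a.
  rewrite aE homog_map_sum /r /=; have [_|nds] := boolP (n - d \in s).
    by rewrite undup_id.
  by rewrite big_cons f0 // homog_map0 add0r undup_id.
(* [g] is the family of components of [phi a - phi a = 0], and its component
   of degree [n] is the sought difference. *)
pose g j := phi (f (j - d)) - (if j == n then phi a else 0).
have := U [seq j + d | j <- r] g.
rewrite map_inj_uniq; last exact: addIr.
rewrite undup_uniq => /(_ isT) H.
suff: g n = 0 by rewrite /g eqxx => /eqP; rewrite subr_eq0 => /eqP ->.
apply: H.
- move=> j; have [Z0 ZB] := Z j; apply: ZB; last by case: eqP => // ->.
  by have := phi_gr (fP (j - d)); rewrite subrK.
- rewrite big_map /g sumrB; under eq_bigr do rewrite addrK.
  rewrite sumr (bigD1_seq (n - d)) ?undup_uniq ?mem_undup ?mem_head //=.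
  rewrite subrK eqxx big1 ?addr0 ?subrr // => i /negPf.
  by rewrite eq_sym subr_eq eq_sym => ->.
- by apply/mapP; exists (n - d); rewrite ?subrK // mem_undup mem_head.
Qed.

End Homogeneous.

(** * Graded simple modules *)

Section GradedTheory.
Variable D : gradedRing.
Implicit Types M N : gradedModule D.

Lemma submod_graded_homog M (U : {pred M}) u :
  graded_submodule U -> u \in U -> u != 0 ->
  exists i w, [/\ w \in gmod_part i, w \in U & w != 0].
Proof.
move=> [_ H] /H[s [f [us fP fU ->]]] /eqP u0; apply: contrapT => nE.
apply: u0; rewrite big1 // => i _; apply: contrapT => /eqP fi.
by apply: nE; exists i, (f i); split.
Qed.

Lemma homog_neq0 M (u : M) : u != 0 ->
  exists i w, w \in gmod_part (g := M) i /\ w != 0.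
Proof.
have [_ S _] := gmod_grading M.
have [s [f [us fP ->]]] := S u => /eqP u0; apply: contrapT => nE.
apply: u0; rewrite big1 // => i _; apply: contrapT => /eqP fi.
by apply: nE; exists i, (f i).
Qed.

(** The multiples of a homogeneous vector form a graded submodule. *)
Lemma simple_cyclic N (n : int) (w u : N) : graded_simple N ->
  w \in gmod_part n -> w != 0 -> exists a : D, u = a *: w.
Proof.
move=> [_ Nsimple] wn w0.
pose U : {pred N} := [pred u | `[< exists a : D, u = a *: w >]].
have gU : graded_submodule U.
  split.
    split=> [|b x y /asboolP[a ->] /asboolP[c ->]]; apply/asboolP.
      by exists 0; rewrite scale0r.
    by exists (b * a + c); rewrite scalerDl scalerA.
  move=> x /asboolP[a ->].
  have [s [f [us fP _ aE]]] := grading_span0 a (gring_grading D).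
  exists [seq i + n | i <- s], (fun i => f (i - n) *: w); split.
  - by rewrite map_inj_uniq //; apply: addIr.
  - by move=> i; have := gmod_scale (fP (i - n)) wn; rewrite subrK.
  - by move=> i; apply/asboolP; exists (f (i - n)).
  - by rewrite big_map aE scaler_suml; apply: eq_bigr => i _; rewrite addrK.
have wU : w \in U by apply/asboolP; exists 1; rewrite scale1r.
case: (Nsimple U gU) => HU.
  by move: wU w0; rewrite HU inE => ->.
by apply/asboolP; have := HU u; rewrite !inE.
Qed.

Lemma simple_homog N (n m : int) (w u : N) : graded_simple N ->
  w \in gmod_part n -> w != 0 -> u \in gmod_part m ->
  exists2 a : D, a \in gring_part (m - n) & u = a *: w.
Proof.
move=> Ns wn w0 um; have [a uE] := simple_cyclic u Ns wn w0.
have [|||b bP abE] := homog_lift (gring_grading D) (gmod_grading N)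
  (phi := fun a : D => a *: w) (d := n) _ _ (n := m) (a := a).
- by move=> x y; rewrite scalerDl.
- by move=> i b bi; apply: gmod_scale.
- by rewrite -uE.
by exists b; rewrite // uE.
Qed.

Section Schur.
Variables (M N : gradedModule D) (f : {linear M -> N}) (d : int).
Hypotheses (Msimple : graded_simple M) (Nsimple : graded_simple N).
Hypothesis f_part :
  forall i v, v \in gmod_part i -> f v \in gmod_part (i + d).
Hypothesis f_neq0 : exists u, f u != 0.

(** The kernel of a homogeneous map is a graded submodule. *)
Lemma schur_inj : injective f.
Proof.
pose U : {pred M} := [pred u | f u == 0].
have gU : graded_submodule U.
  split.
    split=> [|a x y]; rewrite !inE ?linear0 // linearP.
    by move=> /eqP-> /eqP->; rewrite scaler0 addr0.
  move=> u; rewrite inE => /eqP fu0.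
  have [s [g [us gP g0 uE]]] := grading_span0 u (gmod_grading M).
  exists s, g; split=> // i; rewrite inE.
  have [si|/g0 ->] := boolP (i \in s); last by rewrite linear0.
  apply/eqP; apply: (homog_map_direct (gmod_grading N) f_part us) => //.
  by rewrite -linear_sum -uE.
case: f_neq0 => u fu0; apply: raddf_inj => x fx0.
case: (Msimple.2 U gU) => HU.
  by have := HU x; rewrite !inE fx0 eqxx => /esym/eqP.
by have := HU u; rewrite !inE (negPf fu0).
Qed.

(** The image of a homogeneous map is a graded submodule. *)
Lemma schur_surj w : exists u, f u = w.
Proof.
pose U : {pred N} := [pred w | `[< exists u, f u = w >]].
have gU : graded_submodule U.
  split.
    split=> [|a x y /asboolP[u <-] /asboolP[v <-]]; apply/asboolP.
      by exists 0; rewrite linear0.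
    by exists (a *: u + v); rewrite linearP.
  move=> _ /asboolP[u <-]; have [_ S _] := gmod_grading M.
  have [s [g [us gP uE]]] := S u.
  exists [seq i + d | i <- s], (fun i => f (g (i - d))); split.
  - by rewrite map_inj_uniq //; apply: addIr.
  - by move=> i; have := f_part (gP (i - d)); rewrite subrK.
  - by move=> i; apply/asboolP; exists (g (i - d)).
  - by rewrite big_map uE linear_sum; apply: eq_bigr => i _; rewrite addrK.
case: f_neq0 => u fu0.
case: (Nsimple.2 U gU) => HU.
  have := HU (f u); rewrite !inE (negPf fu0) => /asboolP[].
  by exists u.
by apply/asboolP; have := HU w; rewrite !inE.
Qed.

(** Schur's lemma for maps of degree [d]: the twist makes up for the shift. *)
Lemma schur_twist : graded_iso N (twist M (- d)).
Proof.
have /choice[g gP] := schur_surj.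
have gK : cancel f g by move=> u; apply: schur_inj; rewrite gP.
have g_lin : linear g.
  by move=> a x y; apply: schur_inj; rewrite linearP !gP.
pose G : {linear N -> twist M (- d)} :=
  HB.pack g (GRing.isLinear.Build D N (twist M (- d)) _ g g_lin).
pose F : {linear twist M (- d) -> N} := f.
have G_part i v : v \in gmod_part i -> G v \in gmod_part i.
  move=> vi; rewrite -[v]gP in vi *.
  have [|b bP] := homog_lift (gmod_grading M) (gmod_grading N) _ f_part vi.
    exact: raddfD.
  move=> /schur_inj gvE; rewrite /= gK gvE.
  by rewrite -topredE /= addrC.
have F_part i v : v \in gmod_part i -> F v \in gmod_part i.
  by move=> vi; have := f_part vi; rewrite addrAC addNr add0r.
by exists (GradedHom G_part), (GradedHom F_part).
Qed.

End Schur.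

Section Cyclic.
Variables (x : D) (d : int) (xd : x \in gring_part d).
Local Notation M := (cyclicModule xd).
Local Notation pi := (@cyclic_pi D x).

Lemma cyclic_gen_part : pi 1 \in gmod_part (g := M) 0.
Proof. by apply/cyclic_partP; exists 1 => //; apply: gring_one. Qed.

Lemma cyclic_gen_kill : x *: (pi 1 : M) = 0.
Proof.
rewrite [LHS]cyclic_scaleE mulr1; apply/eqP; rewrite cyclic_pi_eq0.
by apply/left_idealP; exists 1; rewrite mul1r.
Qed.

Lemma cyclic_genE (u : M) : exists a : D, u = a *: (pi 1 : M).
Proof.
exists (repr u); rewrite [RHS]cyclic_scaleE mulr1.
by rewrite -[LHS]cyclic_reprK.
Qed.

(** If the generator vanishes then [1] lies in [D x]; its cofactor may be
    taken homogeneous, so that only one graded piece of [D] has to be known. *)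
Lemma cyclic_gen_eq0 : (pi 1 : M) = 0 ->
  exists2 b : D, b \in gring_part (- d) & 1 = b * x.
Proof.
move=> /eqP; rewrite cyclic_pi_eq0 => /left_idealP[b bE].
have [|||c cP bcE] := homog_lift (gring_grading D) (gring_grading D)
  (phi := fun a : D => a * x) (d := d) _ _ (n := 0) (a := b).
- by move=> u v; rewrite mulrDl.
- by move=> i a ai; apply: gring_mul.
- by rewrite -bE; apply: gring_one.
by rewrite add0r in cP; exists c; rewrite // bE.
Qed.

(** The universal property of [D / D x]. *)
Lemma cyclic_lift (N : gradedModule D) (v : N) : x *: v = 0 ->
  exists f : {linear M -> N}, forall a, f (pi a) = a *: v.
Proof.
move=> xv0; pose f (u : M) : N := repr u *: v.
have fE a : f (pi a) = a *: v.
  apply/eqP; rewrite -subr_eq0 -scalerBl.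
  have : repr (pi a) - a \in left_ideal x.
    by rewrite -cyclic_pi_eq cyclic_reprK.
  by case/left_idealP=> b ->; rewrite -scalerA xv0 scaler0.
have f_lin : linear f.
  move=> a u w; rewrite -(cyclic_reprK u) -(cyclic_reprK w).
  rewrite [a *: _]cyclic_scaleE -cyclic_piD !fE.
  by rewrite scalerDl scalerA.
pose F : {linear M -> N} := HB.pack f (GRing.isLinear.Build D M N _ f f_lin).
by exists F.
Qed.

Lemma cyclic_iso (N : gradedModule D) n (v : N) :
  graded_simple M -> graded_simple N ->
  v \in gmod_part n -> v != 0 -> x *: v = 0 -> graded_iso N (twist M (- n)).
Proof.
move=> Ms Ns vn v0 xv0; have [f fE] := cyclic_lift xv0.
apply: (schur_twist (f := f)) => //.
  by move=> i _ /cyclic_partP[a ai ->]; rewrite fE; apply: gmod_scale.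
by exists (pi 1); rewrite fE scale1r.
Qed.

(** A nonzero graded submodule contains a nonzero homogeneous vector, so it is
    enough to recover the generator from each of these. *)
Lemma cyclic_simple : (pi 1 : M) != 0 ->
  (forall i a, a \in gring_part i -> a *: (pi 1 : M) != 0 ->
     exists b, b *: (a *: (pi 1 : M)) = pi 1) ->
  graded_simple M.
Proof.
move=> pi1 H; split; first by exists (pi 1).
move=> U gU; have [[U0 UP] _] := gU.
have UZ b w : w \in U -> b *: w \in U.
  by move=> wU; have := UP b w 0 wU U0; rewrite addr0.
have [[u [uU u0]]|nU] := pselect (exists u, u \in U /\ u != 0); [right|left].
  have [i [w [/cyclic_partP[a ai wE] wU w0]]] := submod_graded_homog gU uU u0.
  have wE' : w = a *: (pi 1 : M) by rewrite [RHS]cyclic_scaleE mulr1.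
  have [|b bE] := H i a ai; first by rewrite -wE'.
  move=> z; have [c ->] := cyclic_genE z.
  by rewrite -bE -wE' !UZ.
move=> u; rewrite inE; apply/idP/eqP => [uU|->]; last exact: U0.
by apply: contrapT => /eqP u0; apply: nU; exists u.
Qed.

(** The image of the generator is the trace that an isomorphism leaves in
    [N]; the converse of [cyclic_iso]. *)
Lemma graded_iso_twist_gen (N : gradedModule D) n : (pi 1 : M) != 0 ->
  graded_iso N (twist M n) ->
  exists v : N, [/\ v \in gmod_part (- n), v != 0 & x *: v = 0].
Proof.
move=> pi1 [h [g [_ gK]]]; exists (g (pi 1)); split.
- by apply: ghom_part; have := cyclic_gen_part; rewrite -{1}(addrN n).
- by rewrite -(raddf0 g) (can_eq gK).
- by rewrite -linearZ /= cyclic_gen_kill raddf0.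
Qed.

End Cyclic.
End GradedTheory.

(** * Weights over rings presented like the Weyl algebra *)

(** The integer power [t^i], where [d] plays the role of the inverse of [t]. *)
Definition zmonom (R : pzRingType) (t d : R) (i : int) : R :=
  match i with Posz n => t ^+ n | Negz n => d ^+ n.+1 end.

(** The properties of the Weyl algebra on which the representation theory rests:
    [wE] is evaluation of polynomials at [t d], and each graded piece is a
    cyclic left module over its image. *)
Record weylRing (k : fieldType) := WeylRing {
  wring :> gradedRing;
  wE : {rmorphism {poly k} -> wring};
  wt : wring;
  wd : wring;
  wt_part : wt \in gring_part 1;
  wd_part : wd \in gring_part (-1);
  wE_part : forall p, wE p \in gring_part 0;
  wtd : wt * wd = wE 'X;
  wdt : wd * wt = wE ('X + 1);
  wt_const : forall c, wt * wE c%:P = wE c%:P * wt;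
  wd_const : forall c, wd * wE c%:P = wE c%:P * wd;
  wE_inj : injective wE;
  wpartE : forall i x, x \in gring_part i ->
    exists p, x = wE p * zmonom wt wd i
}.

Section Weights.
Variables (k : fieldType) (W : weylRing k).
Local Notation t := (wt W).
Local Notation d := (wd W).
Local Notation E := (@wE _ W).
Local Notation mon := (zmonom t d).

Lemma weight_t a : E ('X - (a + 1)%:P) * t = t * E ('X - a%:P).
Proof.
have Et : E 'X * t = t * (E 'X + 1).
  by rewrite -wtd -mulrA wdt rmorphD rmorph1 -wtd.
rewrite polyCD opprD addrA !rmorphB /= rmorph1 !mulrBl Et mulrDr mulrBr mulr1.
by rewrite mul1r wt_const addrAC addrK.
Qed.

Lemma weight_d a : E ('X - (a - 1)%:P) * d = d * E ('X - a%:P).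
Proof.
have Ed : d * E 'X = (E 'X + 1) * d.
  by rewrite -wtd mulrA wdt rmorphD rmorph1 -wtd.
rewrite polyCB opprB addrA !rmorphB rmorphD /= rmorph1.
by rewrite mulrBl mulrBr wd_const Ed.
Qed.

Section Module.
Variable M : gradedModule W.
Implicit Types u v w : M.

(** [v] is an eigenvector of [t d] for the eigenvalue [a], or zero. *)
Definition weight v a := E ('X - a%:P) *: v = 0.

Lemma const_eq0 v c : c != 0 -> E c%:P *: v = 0 -> v = 0.
Proof.
move=> c0 /(congr1 (fun u => E c^-1%:P *: u)).
by rewrite scaler0 scalerA -rmorphM -polyCM mulVf //= rmorph1 scale1r.
Qed.

(** [p - p(a)] is divisible by [X - a]. *)
Lemma weight_act v a p : weight v a -> E p *: v = E p.[a]%:P *: v.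
Proof.
move=> va; apply/eqP; rewrite -subr_eq0 -scalerBl -rmorphB.
have /factor_theorem[q ->] : root (p - p.[a]%:P) a.
  by rewrite /root !hornerE subrr.
by rewrite rmorphM -scalerA va scaler0.
Qed.

Lemma weight_mul_t v a : weight v a -> weight (t *: v) (a + 1).
Proof. by move=> va; rewrite /weight scalerA weight_t -scalerA va scaler0. Qed.

Lemma weight_mul_d v a : weight v a -> weight (d *: v) (a - 1).
Proof. by move=> va; rewrite /weight scalerA weight_d -scalerA va scaler0. Qed.

Lemma weight_mon v a i : weight v a -> weight (mon i *: v) (a + i%:~R).
Proof.
move=> va; case: i => n; rewrite /zmonom.
  elim: n => [|n IH]; first by rewrite expr0 scale1r addr0.
  by rewrite exprS -scalerA intS rmorphD /= addrCA addrC; apply: weight_mul_t.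
rewrite NegzE; elim: n => [|n IH]; first by rewrite expr1; apply: weight_mul_d.
rewrite exprS -scalerA (intS n.+1) opprD rmorphD /= addrCA addrC.
exact: weight_mul_d.
Qed.

(** This is the commutation rule [E x = x (E + i)] for [x] of degree [i]. *)
Lemma weight_homog v a i x : x \in gring_part i -> weight v a ->
  weight (x *: v) (a + i%:~R).
Proof.
case/wpartE=> p -> /(weight_mon i) vi.
by rewrite /weight -scalerA scalerA -rmorphM mulrC rmorphM -scalerA vi scaler0.
Qed.

Lemma weight_uniq v a b : v != 0 -> weight v a -> weight v b -> a = b.
Proof.
move=> v0 va vb; apply/eqP; rewrite -subr_eq0; apply: contraNT v0 => ab.
apply/eqP; apply: (const_eq0 ab).
have -> : (a - b)%:P = 'X - b%:P - ('X - a%:P) :> {poly k}.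
  by rewrite polyCB opprB [RHS]addrC addrA subrK.
by rewrite rmorphB scalerBl va vb subrr.
Qed.

(** The element [d t] acts on [t^n v] by the scalar [a + n + 1]; if no such
    scalar vanishes, [t] can be undone step by step. *)
Lemma weight_return_t v a n :
  t *: v = 0 \/ (forall m, a + m.+1%:R != 0) -> weight v a ->
  t ^+ n *: v != 0 -> exists y : W, y *: (t ^+ n *: v) = v.
Proof.
move=> [tv0|am] va; first case: n => [|n].
- by move=> _; exists 1; rewrite expr0 !scale1r.
- by rewrite exprSr -scalerA tv0 scaler0 eqxx.
elim: n => [|n IH]; first by exists 1; rewrite expr0 !scale1r.
rewrite exprS -scalerA => tnv0.
have [|y yE] := IH; first by apply: contraNneq tnv0 => ->; rewrite scaler0.
exists (y * E (a + n.+1%:R)^-1%:P * d).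
rewrite scalerA -mulrA wdt -!scalerA (weight_act _ (weight_mon n va)).
rewrite !hornerE [E _ *: (E _ *: _)]scalerA -rmorphM -polyCM.
rewrite -[_ + 1]addrA [n%:~R + 1]addrC -[n%:~R]/(n%:R) -mulrS mulVf //.
by rewrite rmorph1 scale1r.
Qed.

(** Likewise [t d] acts on [d^n v] by the scalar [a - n]. *)
Lemma weight_return_d v a n :
  d *: v = 0 \/ (forall m, a - m%:R != 0) -> weight v a ->
  d ^+ n *: v != 0 -> exists y : W, y *: (d ^+ n *: v) = v.
Proof.
move=> [dv0|am] va; first case: n => [|n].
- by move=> _; exists 1; rewrite expr0 !scale1r.
- by rewrite exprSr -scalerA dv0 scaler0 eqxx.
elim: n => [|n IH]; first by exists 1; rewrite expr0 !scale1r.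
rewrite exprS -scalerA => dnv0.
have [|y yE] := IH; first by apply: contraNneq dnv0 => ->; rewrite scaler0.
exists (y * E (a - n%:R)^-1%:P * t).
have vn : weight (d ^+ n *: v) (a - n%:R).
  have := weight_mon (- n%:Z) va; rewrite rmorphN /=.
  by case: (n).
rewrite scalerA -mulrA wtd -!scalerA (weight_act _ vn).
rewrite !hornerE [E _ *: (E _ *: _)]scalerA -rmorphM -polyCM mulVf //.
by rewrite rmorph1 scale1r.
Qed.

(** Up to a polynomial in [t d], which acts by a scalar, [x] is a power of [t]
    or of [d]. *)
Lemma weight_return v a i x :
  t *: v = 0 \/ (forall m, a + m.+1%:R != 0) ->
  d *: v = 0 \/ (forall m, a - m%:R != 0) ->
  weight v a -> x \in gring_part i -> x *: v != 0 ->
  exists y : W, y *: (x *: v) = v.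
Proof.
move=> tv dv va /wpartE[p ->]; rewrite -scalerA (weight_act p (weight_mon i va)).
set c := p.[_] => cv0.
have c0 : c != 0 by apply: contraNneq cv0 => ->; rewrite polyC0 rmorph0 scale0r.
have mv0 : mon i *: v != 0 by apply: contraNneq cv0 => ->; rewrite scaler0.
have [y yE] : exists y : W, y *: (mon i *: v) = v.
  case: i mv0 {cv0 c c0} => n mv0; first exact: weight_return_t tv va mv0.
  exact: weight_return_d dv va mv0.
exists (y * E c^-1%:P); rewrite -scalerA [E _ *: (E _ *: _)]scalerA.
by rewrite -rmorphM -polyCM mulVf // rmorph1 scale1r.
Qed.

(** Applying the linear factors one by one, the last nonzero vector before
    reaching zero is an eigenvector. *)
Lemma split_weight (s : seq k) n v : v \in gmod_part n -> v != 0 ->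
  E (\prod_(z <- s) ('X - z%:P)) *: v = 0 ->
  exists a w, [/\ w \in gmod_part n, w != 0 & weight w a].
Proof.
elim: s v => [|z s IH] v vn v0.
  by rewrite big_nil rmorph1 scale1r => vE; rewrite vE eqxx in v0.
rewrite big_cons mulrC rmorphM -scalerA => sv0.
have [vz|vz] := eqVneq (E ('X - z%:P) *: v) 0; first by exists z, v.
by apply: IH sv0 => //; have := gmod_scale (wE_part _ ('X - z%:P)) vn; rewrite add0r.
Qed.

(** When neither [t] nor [d] kills a homogeneous vector, all translates of a
    weight by integers are weights. *)
Lemma weight_shift n a w :
  (forall i u, u \in gmod_part i -> t *: u = 0 -> u = 0) ->
  (forall i u, u \in gmod_part i -> d *: u = 0 -> u = 0) ->
  w \in gmod_part n -> w != 0 -> weight w a ->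
  forall m : int, exists j u,
    [/\ u \in gmod_part j, u != 0 & weight u (a + m%:~R)].
Proof.
move=> tinj dinj wn w0 wa.
case; elim=> [|m [j [u [uj u0 ua]]]].
- by exists n, w; split; rewrite // addr0.
- exists (1 + j), (t *: u); split; first exact: gmod_scale (wt_part W) uj.
    by apply: contra_neq u0 => /(tinj _ _ uj).
  by rewrite intS rmorphD /= addrCA addrC; apply: weight_mul_t.
- exists (-1 + n), (d *: w); split; first exact: gmod_scale (wd_part W) wn.
    by apply: contra_neq w0 => /(dinj _ _ wn).
  exact: weight_mul_d.
exists (-1 + j), (d *: u); split; first exact: gmod_scale (wd_part W) uj.
  by apply: contra_neq u0 => /(dinj _ _ uj).
rewrite NegzE (intS m.+1) opprD rmorphD /= addrCA addrC -NegzE.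
exact: weight_mul_d.
Qed.

End Module.

Section Cyclic.
Variables (x : W) (e : int) (xe : x \in gring_part e) (a : k).
(** The one property of the generators [d], [t] and [t d - a] of the left ideals
    that makes a uniform treatment possible: a power of [t] or [d] turns each of
    them into some [t d - a]. *)
Hypothesis xE : mon (- e) * x = E ('X - a%:P).
Local Notation M := (cyclicModule xe).
Local Notation gen := (@cyclic_pi W x 1 : M).

Lemma weight_of_kill (N : gradedModule W) (v : N) : x *: v = 0 -> weight v a.
Proof. by move=> xv; rewrite /weight -xE -scalerA xv scaler0. Qed.

(** Otherwise [1 = p(t d) (t d - a)], an identity between polynomials in [t d]
    that fails at [a]. *)
Lemma cyclic_gen_neq0 : gen != 0.
Proof.
apply/eqP => /(cyclic_gen_eq0 (xd := xe))[_ /wpartE[p ->]].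
rewrite -mulrA xE -rmorphM -(rmorph1 E) => /wE_inj/(congr1 (horner^~ a)).
by rewrite !hornerE subrr mulr0 => /eqP; rewrite oner_eq0.
Qed.

(** In each direction, either the generator is killed at once or the scalars
    of [weight_return_t] and [weight_return_d] are all nonzero. *)
Lemma weight_cyclic_simple :
  (exists b, t = b * x) \/ (forall m, a + m.+1%:R != 0) ->
  (exists b, d = b * x) \/ (forall m, a - m%:R != 0) ->
  graded_simple M.
Proof.
move=> tx dx; apply: cyclic_simple; first exact: cyclic_gen_neq0.
have kill := cyclic_gen_kill xe.
move=> i y yi; apply: (weight_return _ _ (weight_of_kill kill) yi).
  by case: tx => [[b ->]|]; [left; rewrite -scalerA kill scaler0 | right].
by case: dx => [[b ->]|]; [left; rewrite -scalerA kill scaler0 | right].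
Qed.

End Cyclic.
End Weights.

Section Existence.
Variables (k : closedFieldType) (W : weylRing k).
Local Notation E := (@wE _ W).
Variable (N : gradedModule W).
Hypothesis (Nsimple : graded_simple N).

(** The vector [E v] generates [N], so [v = p(E) E v] for some [p]: [v] is
    killed by the nonzero polynomial [p X - 1] in [E], which splits. *)
Lemma simple_weight : exists n a (w : N),
  [/\ w \in gmod_part n, w != 0 & weight w a].
Proof.
have [[v0 v0_neq0] _] := Nsimple.
have [n [v [vn v_neq0]]] := homog_neq0 v0_neq0.
have [Ev0|Ev_neq0] := eqVneq (E 'X *: v) 0.
  by exists n, 0, v; split; rewrite // /weight subr0.
have Evn : E 'X *: v \in gmod_part n.
  by have := gmod_scale (wE_part W 'X) vn; rewrite add0r.
have [b] := simple_homog Nsimple Evn Ev_neq0 vn.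
rewrite subrr => /wpartE[p ->]; rewrite /= mulr1 scalerA -rmorphM => vE.
have P0 : p * 'X - 1 != 0.
  apply/eqP => /(congr1 (horner^~ 0)); rewrite !hornerE.
  by move/eqP; rewrite oppr_eq0 oner_eq0.
have [s sE] := closed_field_poly_normal (p * 'X - 1).
have [|a [w wP]] := @split_weight _ W N s n v vn v_neq0; last by exists n, a, w.
apply: (@const_eq0 _ W N _ (lead_coef (p * 'X - 1))); first by rewrite lead_coef_eq0.
rewrite scalerA -rmorphM mul_polyC -sE rmorphB rmorph1 scalerBl -vE scale1r.
exact: subrr.
Qed.

End Existence.

(** * The graded pieces of the Weyl algebra *)

Section Words.
Variables (k : fieldType) (A : algType k) (t d : A).
Hypothesis dt : d * t = t * d + 1.
Local Notation E := (horner_alg (t * d)).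
Local Notation mon := (zmonom t d).

Lemma mul_t_poly p : exists q, t * E p = E q * t.
Proof.
elim/poly_ind: p => [|p c [q qE]].
  by exists 0; rewrite !rmorph0 mul0r mulr0.
exists (q * ('X - 1) + c%:P).
rewrite !rmorphD !rmorphM !rmorphB /= !horner_algX !horner_algC scale1r.
rewrite mulrDr mulrDl -scalerAr -scalerAl mulr1 mul1r [t * _]mulrA qE -!mulrA.
congr (_ * _ + _).
by rewrite mulrBl mul1r -mulrA dt mulrDr mulr1 addrK.
Qed.

Lemma mul_d_poly p : exists q, d * E p = E q * d.
Proof.
elim/poly_ind: p => [|p c [q qE]].
  by exists 0; rewrite !rmorph0 mul0r mulr0.
exists (q * ('X + 1) + c%:P).
rewrite !rmorphD !rmorphM !rmorphD /= !horner_algX !horner_algC scale1r.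
rewrite mulrDr mulrDl -scalerAr -scalerAl mulr1 mul1r [d * _]mulrA qE -!mulrA.
congr (_ * _ + _).
by rewrite mulrDl mul1r [d * _]mulrA dt mulrDl mul1r.
Qed.

Lemma mul_t_mon i : exists q, t * mon i = E q * mon (1 + i).
Proof.
case: i => [n|[|n]].
- by exists 1; rewrite rmorph1 mul1r /= exprS.
- by exists 'X; rewrite horner_algX /= mulr1.
- by exists 'X; rewrite horner_algX /= [d ^+ n.+2]exprS mulrA subn1.
Qed.

Lemma mul_d_mon i : exists q, d * mon i = E q * mon (-1 + i).
Proof.
case: i => [[|n]|n].
- by exists 1; rewrite rmorph1 mul1r /= mulr1.
- exists ('X + 1); rewrite rmorphD rmorph1 /= horner_algX exprS mulrA dt.
  by rewrite subn1.
- by exists 1; rewrite rmorph1 mul1r /= -exprS.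
Qed.

(** Every word in [t] and [d] is a polynomial in [t d] times a power of [t] or
    [d]: read it from right to left, absorbing one letter at a time. *)
Lemma wordE (s : seq bool) : exists p,
  \prod_(b <- s) (if b then d else t)
    = E p * mon ((count_mem false s)%:Z - (count_mem true s)%:Z).
Proof.
elim: s => [|b s [p IH]]; first by exists 1; rewrite big_nil rmorph1 mul1r.
rewrite big_cons IH; case: b => /=.
  have [q qE] := mul_d_poly p.
  have [r rE] := mul_d_mon ((count_mem false s)%:Z - (count_mem true s)%:Z).
  exists (q * r); rewrite mulrA qE -mulrA rE mulrA -rmorphM add0n.
  by rewrite (intS (count_mem true s)) opprD addrCA.
have [q qE] := mul_t_poly p.
have [r rE] := mul_t_mon ((count_mem false s)%:Z - (count_mem true s)%:Z).
exists (q * r); rewrite mulrA qE -mulrA rE mulrA -rmorphM add0n.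
by rewrite (intS (count_mem false s)) addrA.
Qed.

End Words.

Section WeylAlgebraStructure.
Variable k : numFieldType.
Local Notation t := (weyl_t k).
Local Notation d := (weyl_d k).
Local Notation E := (horner_alg (t * d)).

Lemma weyl_dt : d * t = t * d + 1.
Proof. by rewrite -(weyl_commutator k) addrC subrK. Qed.

Lemma weyl_pi_word (s : seq bool) :
  weyl_pi << FMonom s >> = \prod_(b <- s) (if b then d else t) :> weyl k.
Proof.
elim: s => [|b s IH].
  rewrite big_nil -[RHS]/(weyl_pi 1); congr (weyl_pi << _ >>).
  by apply/val_inj; rewrite /= [mone]fmoneE.
rewrite big_cons -IH; have -> : << FMonom (b :: s) >> =
    << fmu b >> * << FMonom s >> :> free2 k.
  rewrite malgM_def fgmulUU mulr1; congr << _ >>.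
  by apply/val_inj; rewrite /= [mmul _ _]fmmulE fmuE.
by rewrite weyl_piM; case: b.
Qed.

Lemma weyl_partE i x : x \in weyl_part i ->
  exists p, x = E p * zmonom t d i.
Proof.
case/weyl_partP=> a /allP aP ->; rewrite [a]monalgE big_seq.
apply: (big_ind (fun z => exists p, weyl_pi z = E p * zmonom t d i)).
- by exists 0; rewrite rmorph0 mul0r; apply/eqP; rewrite weyl_pi_eq0 rpred0.
- move=> y z [p pE] [q qE]; exists (p + q).
  by rewrite rmorphD mulrDl weyl_piD pE qE.
move=> m /aP/eqP <-; case: m => s.
have [p pE] : exists p, _ = E p * zmonom t d (wdeg (FMonom s)) :=
  wordE weyl_dt s.
exists (a@_(FMonom s) *: p); rewrite linearZ /= -!scalerAl mul1r -pE -weyl_pi_word.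
by rewrite -weyl_piZ -mul_malgC malgM_def fgmulUU mul1m mulr1.
Qed.

(** The representation of the Weyl algebra by differential operators on
    [k[X]]. *)
Definition weyl_act (x : weyl k) (p : {poly k}) := act (repr x) p.

Lemma weyl_act_pi a p : weyl_act (weyl_pi a) p = act a p.
Proof.
apply/eqP; rewrite -subr_eq0 -actN -actD; apply/eqP; apply: act_weyl_ideal.
by rewrite -weyl_pi_eq weyl_reprK.
Qed.

Lemma weyl_actD x y p : weyl_act (x + y) p = weyl_act x p + weyl_act y p.
Proof.
rewrite -(weyl_reprK x) -(weyl_reprK y) -weyl_piD !weyl_act_pi; exact: actD.
Qed.

Lemma weyl_actM x y p : weyl_act (x * y) p = weyl_act x (weyl_act y p).
Proof.
rewrite -(weyl_reprK x) -(weyl_reprK y) -weyl_piM !weyl_act_pi; exact: actM.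
Qed.

Lemma weyl_act_const (c : k) p : weyl_act c%:A p = c *: p.
Proof.
rewrite -[c%:A]weyl_piZ weyl_act_pi -mul_malgC mulr1 actU.
by rewrite /act_word [mone]fmoneE.
Qed.

Lemma weyl_act_E n : weyl_act (t * d) 'X^n = n%:R *: 'X^n.
Proof.
rewrite weyl_actM !weyl_act_pi !actU !scale1r /act_word !fmuE /=.
rewrite derivXn; case: n => [|n]; first by rewrite mulr0n mulr0 scale0r.
by rewrite mulrnAr -exprS scaler_nat.
Qed.

Lemma weyl_act_poly p n : weyl_act (E p) 'X^n = p.[n%:R] *: 'X^n.
Proof.
have actZ c q x : weyl_act x (c *: q) = c *: weyl_act x q.
  by rewrite -!weyl_act_const -!weyl_actM mulr_algr mulr_algl.
elim/poly_ind: p => [|p c IH].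
  have -> : E 0 = 0%:A by rewrite rmorph0 scale0r.
  by rewrite weyl_act_const horner0.
rewrite rmorphD rmorphM /= horner_algX horner_algC weyl_actD weyl_actM.
by rewrite weyl_act_E actZ IH weyl_act_const scalerA !hornerE scalerDl mulrC.
Qed.

(** If [p(E) = 0] then [p] vanishes at all eigenvalues of [E] on [k[X]], that
    is at all natural numbers, of which there are infinitely many in [k]. *)
Lemma horner_weyl_inj : injective E.
Proof.
apply: raddf_inj => p Ep0; apply/eqP; apply: contraT => p0.
pose r := [seq n%:R : k | n <- iota 0 (size p)].
have : (size r < size p)%N.
  apply: max_poly_roots => //.
    apply/allP => _ /mapP[n _ ->]; rewrite /root.
    have := weyl_act_poly p n; rewrite Ep0 -[0](scale0r 1) weyl_act_const scale0r.
    by move/esym/eqP; rewrite scaler_eq0 -size_poly_eq0 size_polyXn orbF.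
  by rewrite map_inj_uniq ?iota_uniq //; apply: mulrIn; apply: oner_neq0.
by rewrite size_map size_iota ltnn.
Qed.

Lemma horner_weyl_part p : E p \in weyl_part 0.
Proof.
have [_ ZB] := grading_zmod (weyl_grading k) 0.
elim/poly_ind: p => [|p c IH].
  by rewrite rmorph0; case: (grading_zmod (weyl_grading k) 0).
rewrite rmorphD rmorphM /= horner_algX horner_algC.
have Ec (a : k) := weyl_E_part a.
have E0 : t * d \in weyl_part 0 by have := Ec 0; rewrite scale0r subr0.
rewrite -[c%:A]opprK; apply: (ZB); first by have := weyl_partM IH E0; rewrite addr0.
by have := ZB _ _ (Ec c) E0; rewrite addrAC subrr add0r.
Qed.

Definition A1_weylRing : weylRing k.
Proof.
refine (@WeylRing k (A1 k) (horner_alg (weyl_t k * weyl_d k)) (weyl_t k) (weyl_d k)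
  (weyl_t_part k) (weyl_d_part k) horner_weyl_part _ _ _ _ horner_weyl_inj
  weyl_partE).
- by rewrite /= horner_algX.
- by rewrite /= rmorphD rmorph1 /= horner_algX; apply: weyl_dt.
- by move=> c; rewrite /= horner_algC; rewrite mulr_algl mulr_algr.
- by move=> c; rewrite /= horner_algC; rewrite mulr_algl mulr_algr.
Defined.

End WeylAlgebraStructure.

(** * Classification *)

Section Labels.
Variable R : realType.
Local Notation C := (R[i]).
Local Notation W := (A1_weylRing C).

Lemma Re_int (m : int) : complex.Re (m%:~R : C) = m%:~R.
Proof. by rewrite raddfMz. Qed.

Lemma Jstar_int_shift (a b : C) (m : int) :
  0 <= complex.Re a < 1 -> 0 <= complex.Re b < 1 -> b = a + m%:~R -> a = b.
Proof.
move=> /andP[a0 a1] /andP[b0 b1] bE.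
have : complex.Re b = complex.Re a + m%:~R by rewrite bE raddfD /= Re_int.
move=> ReE; suff m0 : m = 0 by rewrite bE m0 addr0.
have m1 : m < 1.
  by rewrite -(ltrz1 R) -(ltrD2l (complex.Re a)) -ReE (lt_le_trans b1) // lerDr.
have m2 : -1 < m.
  by rewrite -(ltr_int R) -(ltrD2l (complex.Re a)) -ReE (lt_le_trans _ b0) // subr_lt0.
by apply/eqP; rewrite eq_le -ltzD1 add0r m1 -[0 <= m]/(-1 + 1 <= m) lezD1.
Qed.

Lemma Jstar_neq_int (a : C) (m : int) : a \in Jstar R -> a != m%:~R.
Proof.
move=> /andP[aR]; apply: contra_neq => aE.
apply: (@Jstar_int_shift _ _ (- m)) => //; first by rewrite /= lexx ltr01.
by rewrite aE rmorphN subrr.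
Qed.

Definition label_deg (l : label R) : int :=
  match l with Lzero => -1 | Linfty => 1 | Lalpha _ _ => 0 end.

(** The eigenvalue of [E] on the class of 1; on [D/Dt] it is [-1] because
    [t d = d t - 1]. *)
Definition label_weight (l : label R) : C :=
  match l with Lzero => 0 | Linfty => -1 | Lalpha a _ => a end.

Definition label_gen (l : label R) : W :=
  match l with
  | Lzero => weyl_d C
  | Linfty => weyl_t C
  | Lalpha a _ => weyl_E C - a%:A
  end.

Definition label_part l : label_gen l \in gring_part (label_deg l) :=
  match l with
  | Lzero => weyl_d_part C
  | Linfty => weyl_t_part C
  | Lalpha a _ => weyl_E_part a
  end.

Lemma M_cyclic (l : label R) : M_ l = cyclicModule (label_part l).
Proof. by case: l. Qed.

Lemma label_genE l : zmonom (wt W) (wd W) (- label_deg l) * label_gen l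
  = wE W ('X - (label_weight l)%:P).
Proof.
case: l => [||a aJ].
- by rewrite subr0 -wtd.
- by rewrite polyCN opprK -wdt.
- rewrite rmorphB /= horner_algX horner_algC; exact: mul1r.
Qed.

Lemma label_simple (l : label R) : graded_simple (M_ l).
Proof.
rewrite M_cyclic.
have := (@weight_cyclic_simple _ W _ _ (label_part l) _ (label_genE l)).
apply.
- case: l => [||a aJ]; [right=> m|left|right=> m].
  + by rewrite add0r pnatr_eq0.
  + by exists 1; rewrite mul1r.
  + by rewrite addr_eq0 -[m.+1%:R]/(m.+1%:~R) -rmorphN Jstar_neq_int.
- case: l => [||a aJ]; [left|right=> m|right=> m].
  + by exists 1; rewrite mul1r.
  + by rewrite -opprD oppr_eq0 -mulrS pnatr_eq0.
  + by rewrite subr_eq0 (Jstar_neq_int m).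
Qed.

Section SimpleModule.
Variable N : gradedModule W.
Hypothesis Nsimple : graded_simple N.

Lemma label_iso l n (v : N) : v \in gmod_part n -> v != 0 ->
  label_gen l *: v = 0 -> graded_iso N (twist (M_ l) (- n)).
Proof.
move=> vn v0 lv; have := label_simple l; rewrite M_cyclic => Ml.
exact: (cyclic_iso Ml Nsimple vn v0 lv).
Qed.

Lemma label_of_iso l n : graded_iso N (twist (M_ l) n) ->
  exists v : N, [/\ v \in gmod_part (- n), v != 0 & label_gen l *: v = 0].
Proof.
rewrite M_cyclic => /graded_iso_twist_gen; apply.
exact: (cyclic_gen_neq0 _ (label_genE l)).
Qed.

(** If [t] or [d] kills a homogeneous vector, the latter generates a twist of
    [D/Dt] or [D/Dd]; otherwise a weight can be translated into [0 <= Re < 1]. *)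
Lemma label_exists : exists l n, graded_iso N (twist (M_ l) n).
Proof.
have [[n [v [vn v0 dv]]]|nd] := pselect (exists n (v : N),
    [/\ v \in gmod_part n, v != 0 & wd W *: v = 0]).
  by exists (Lzero R), (- n); apply: (@label_iso (Lzero R) n v).
have [[n [v [vn v0 tv]]]|nt] := pselect (exists n (v : N),
    [/\ v \in gmod_part n, v != 0 & wt W *: v = 0]).
  by exists (Linfty R), (- n); apply: (@label_iso (Linfty R) n v).
have tinj i (u : N) : u \in gmod_part i -> wt W *: u = 0 -> u = 0.
  by move=> ui tu; apply: contrapT => /eqP u0; apply: nt; exists i, u.
have dinj i (u : N) : u \in gmod_part i -> wd W *: u = 0 -> u = 0.
  by move=> ui du; apply: contrapT => /eqP u0; apply: nd; exists i, u.
have [n [a [w [wn w0 wa]]]] := simple_weight Nsimple.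
have [j [u [uj u0]]] :=
  weight_shift tinj dinj wn w0 wa (- Num.floor (complex.Re a)).
set b := a + _ => ub.
have bR : 0 <= complex.Re b < 1.
  rewrite raddfD /= Re_int rmorphN /= subr_ge0 ltrBlDl.
  by rewrite floor_le; have := floorD1_gt (complex.Re a); rewrite intrD.
have b0 : b != 0.
  apply: contra_neq u0 => b0; move: ub; rewrite /weight b0 subr0 -wtd -scalerA.
  by move=> /tinj-/(_ _ (gmod_scale (wd_part W) uj))/(dinj _ _ uj).
have bJ : b \in Jstar R by rewrite inE bR.
exists (Lalpha bJ), (- j); apply: (@label_iso (Lalpha bJ) j u uj u0).
move: ub; rewrite /weight -(label_genE (Lalpha bJ)) -scalerA scale1r; exact.
Qed.

(** [D/Dd] and [D/Dt] have weights in the same class modulo the integers, so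
    they need this separate argument: [v] has weight 0 and [w] weight -1, so
    [w] is in [D_(-1) v], which is [k[E] d v = 0]. *)
Lemma kill_td i j (v w : N) : v \in gmod_part i -> v != 0 -> wd W *: v = 0 ->
  w \in gmod_part j -> w != 0 -> wt W *: w = 0 -> False.
Proof.
move=> vi v0 dv wj w0 tw.
have v_weight := weight_of_kill (label_genE (Lzero R)) dv.
have w_weight := weight_of_kill (label_genE (Linfty R)) tw.
have [a aij wE] := simple_homog Nsimple vi v0 wj.
have := weight_homog aij v_weight; rewrite -wE => /(weight_uniq w0 w_weight).
rewrite add0r => /(@intr_inj C (-1) (j - i)) ijE; move: aij; rewrite -ijE.
case/wpartE=> p aE; move: w0; rewrite wE aE -scalerA.
by rewrite [zmonom _ _ _]expr1 dv scaler0 eqxx.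
Qed.

(** Both generators are sent into [N], where each is obtained from the other by
    a homogeneous element, which translates weights by its degree. *)
Lemma label_weight_iso l l' n n' : graded_iso N (twist (M_ l) n) ->
  graded_iso N (twist (M_ l') n') ->
  exists m : int, label_weight l' = label_weight l + m%:~R.
Proof.
move=> /label_of_iso[v [vn v0 lv]] /label_of_iso[v' [vn' v0' lv']].
have v_weight := weight_of_kill (label_genE l) lv.
have v'_weight := weight_of_kill (label_genE l') lv'.
have [a aP v'E] := simple_homog Nsimple vn v0 vn'.
have := weight_homog aP v_weight; rewrite -v'E => /(weight_uniq v0' v'_weight).
by exists (- n' - - n).
Qed.

Lemma label_uniq l l' n n' : graded_iso N (twist (M_ l) n) ->
  graded_iso N (twist (M_ l') n') -> l = l'.
Proof.
move=> isol isol'.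
have [m mE] := label_weight_iso isol isol'.
have [v [vn v0 lv]] := label_of_iso isol.
have [w [wn w0 lw]] := label_of_iso isol'.
case: l l' {isol isol'} mE lv lw => [||a aJ] [||b bJ] //= mE lv lw.
- by case: (kill_td vn v0 lv wn w0 lw).
- by case/eqP: (Jstar_neq_int m bJ); rewrite mE add0r.
- by case: (kill_td wn w0 lw vn v0 lv).
- by case/eqP: (Jstar_neq_int (-1 + m) bJ); rewrite mE rmorphD.
- by case/eqP: (Jstar_neq_int (- m) aJ); rewrite rmorphN -sub0r mE addrK.
- have aE : a = -1 - m%:~R by rewrite mE addrK.
  by case/eqP: (Jstar_neq_int (-1 - m) aJ); rewrite rmorphB.
have ab : a = b.
  by case/andP: (aJ) => aR _; case/andP: (bJ) => bR _; apply: Jstar_int_shift mE.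
by case: b / ab bJ {mE lw} => bJ; congr Lalpha; apply: bool_irrelevance.
Qed.

End SimpleModule.
End Labels.

Theorem corollary11 (R : realType) :
  (forall l : label R, graded_simple (M_ l)) /\
  (forall N : gradedModule (A1 R[i]), graded_simple N ->
     exists! l : label R, exists n : int, graded_iso N (twist (M_ l) n)).
Proof.
split=> [l|N Ns]; first exact: label_simple.
have [l [n iso_l]] := @label_exists R N Ns; exists l; split; first by exists n.
by move=> l' [n' iso_l']; apply: (@label_uniq R N Ns _ _ _ _ iso_l iso_l').
Qed.
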